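(* Let player $B$ use a count-based learning rule $f:\mathbb{N}^{k_A}\to\Delta(\mathcal{B})$ (with unlimited memory) in a $T$-round repeated game. Consider the dynamic program with table $V$ indexed by count vectors $(c_1,\dots,c_{k_A})\in\mathbb{N}^{k_A}$ with $1\le\sum_i c_i\le T$, initialized at the vectors with sum $1$ by $$V[0,\dots,c_i=1,\dots,0]=\bar u^A(a_i,f(0,\dots,0)),$$ and filled in increasing order of $\sum_i c_i=2,\dots,T$ by $$V[c_1,\dots,c_{k_A}]=\max_{i\in[k_A]:\,c_i\ge1}\Big[V[c_1,\dots,c_i-1,\dots,c_{k_A}]+\bar u^A\big(a_i,f(c_1,\dots,c_i-1,\dots,c_{k_A})\big)\Big].$$ Then the maximum of $V[c_1,\dots,c_{k_A}]$ over count vectors with $\sum_i c_i=T$ equals the maximum expected cumulative payoff of player $A$ over $T$ rounds against $f$, and the dynamic program runs in time $O(k_A^2k_BT^{k_A})$. An optimal sequence of actions is recovered via an auxiliary array that stores, for each table entry, a sequence achieving the payoff in $V[c_1,\dots,c_{k_A}]$.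
   Context: Setting. A two-player normal-form game is repeated for $T$ rounds. Player $A$ (the optimizer) has actions $\mathcal{A}=\{a_1,\dots,a_{k_A}\}$, player $B$ (the opponent) has actions $\mathcal{B}=\{b_1,\dots,b_{k_B}\}$, with utilities $u^A,u^B:\mathcal{A}\times\mathcal{B}\to\mathbb{R}$. For $a\in\mathcal{A}$ and $\beta\in\Delta(\mathcal{B})$ (mixed actions of $B$), $\bar u^A(a,\beta)=\sum_{j=1}^{k_B}\beta(b_j)u^A(a,b_j)$. A count-based learning rule is a function $f:\mathbb{N}^{k_A}\to\Delta(\mathcal{B})$: in round $t$, player $B$ plays the mixed action $f(c_1,\dots,c_{k_A})$, where $c_i$ is the number of times $A$ played $a_i$ in rounds $1,\dots,t-1$ (so $\sum_ic_i=t-1$). The expected cumulative payoff of a sequence $x_1,\dots,x_T\in\mathcal{A}$ is $\sum_{t=1}^T\bar u^A(x_t,f([x_1,\dots,x_{t-1}]))$, where $f([x_1,\dots,x_{t-1}])$ means $f$ applied to the counts of the listed actions. Computational convention: given a count vector, the output of $f$ can be computed in $O(k_Ak_B)$ time; arithmetic operations take unit time. *)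

(* Defs.v *)
From mathcomp Require Import all_boot all_order all_algebra.
From mathcomp Require Import classical_sets reals.

Set Implicit Arguments.
Unset Strict Implicit.
Unset Printing Implicit Defensive.

Import Order.TTheory GRing.Theory Num.Theory.

Local Open Scope ring_scope.

Record mixed (R : realType) (k : nat) := Mixed {
  prob :> 'I_k -> R;
  prob_ge0 : forall j, 0 <= prob j;
  prob_sum1 : \sum_j prob j = 1
}.

Record game (R : realType) (kA kB : nat) := Game {
  utilA : 'I_kA -> 'I_kB -> R;
  utilB : 'I_kA -> 'I_kB -> R
}.

Definition counts (k : nat) := {ffun 'I_k -> nat}.

Definition count_rule (R : realType) (kA kB : nat) := counts kA -> mixed R kB.

Section CountVectors.
Variable k : nat.
Implicit Types (c : counts k) (i : 'I_k).

Definition zero_counts : counts k := [ffun=> 0%N].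
Definition set_counts c i (n : nat) : counts k :=
  [ffun j => if j == i then n else c j].
Definition unit_counts i : counts k := set_counts zero_counts i 1.
Definition dec_counts c i : counts k := set_counts c i (c i).-1.
Definition rounds c : nat := (\sum_i c i)%N.
Definition counts_of (x : seq 'I_k) : counts k := [ffun i => count_mem i x].

End CountVectors.

Definition is_max (R : realType) (A : set R) (m : R) : Prop := A m /\ ubound A m.

Section Repeated.
Variables (R : realType) (kA kB : nat).
Variables (G : game R kA kB) (f : count_rule R kA kB).

Definition mixed_utilA (a : 'I_kA) (beta : mixed R kB) : R :=
  \sum_j beta j * utilA G a j.

(* The 0-based round t is played after the first t actions of x, so the
   opponent then plays f at the counts of take t x. *)
Definition payoff (x : seq 'I_kA) : R :=
  \sum_(t < size x)
    mixed_utilA (tnth (in_tuple x) t) (f (counts_of (take t x))).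

Definition is_dp_table (T : nat) (V : counts kA -> R) : Prop :=
  (forall i, V (unit_counts i) = mixed_utilA i (f (zero_counts kA))) /\
  (forall c, (2 <= rounds c <= T)%N ->
     is_max [set v | exists2 i, (0 < c i)%N &
               v = V (dec_counts c i) + mixed_utilA i (f (dec_counts c i))]
            (V c)).

End Repeated.

(* Cost model.  A computation acts on a memory and returns its result, the
   final memory and the time spent.  Arithmetic operations, comparisons,
   accesses to a one-dimensional array, allocation of a list cell and each test
   of a loop condition take one unit; an access to a table indexed by count
   vectors takes kA units, one for each coordinate of the index. *)

(* [cnt] is the working count vector, a mutable array that indexes every table
   access and every call to the rule; [tabV] is the table V; [tabS] is the
   auxiliary array of action sequences, which are stored as linked lists with
   the last action first, so that the entries share their tails. *)
Record memory (R : realType) (kA : nat) := Memory {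
  cnt : counts kA;
  tabV : counts kA -> R;
  tabS : counts kA -> seq 'I_kA
}.

Definition timed (R : realType) (kA : nat) (X : Type) : Type :=
  memory R kA -> X * memory R kA * nat.

Section Monad.
Variables (R : realType) (kA : nat).
Implicit Types X Y : Type.

Definition ret X (x : X) : timed R kA X := fun s => (x, s, 0%N).

Definition bind X Y (m : timed R kA X) (k : X -> timed R kA Y) : timed R kA Y :=
  fun s => let: (x, s1, n1) := m s in
           let: (y, s2, n2) := k x s1 in (y, s2, (n1 + n2)%N).

Definition op X (x : X) : timed R kA X := fun s => (x, s, 1%N).

End Monad.

Arguments ret {R kA X} x.
Arguments bind {R kA X Y} m k.
Arguments op {R kA X} x.

Notation "'let*' x ':=' m 'in' k" := (bind m (fun x => k))
  (at level 200, x name, m at level 100, k at level 200, right associativity).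

Section Primitives.
Variables (R : realType) (kA kB : nat).
Implicit Types X Y : Type.
Local Notation C := (timed R kA).

Fixpoint foreach X Y (l : seq X) (body : X -> Y -> C Y) (y : Y) : C Y :=
  if l is x :: l' then
    let* y0 := op y in
    let* y1 := body x y0 in
    foreach l' body y1
  else op y.

Definition get_cnt (i : 'I_kA) : C nat := fun s => (cnt s i, s, 1%N).

Definition set_cnt (i : 'I_kA) (n : nat) : C unit :=
  fun s => (tt, Memory (set_counts (cnt s) i n) (tabV s) (tabS s), 1%N).

Definition read_V : C R := fun s => (tabV s (cnt s), s, kA).

Definition write_V (v : R) : C unit :=
  fun s => (tt, Memory (cnt s)
                       (fun c => if c == cnt s then v else tabV s c)
                       (tabS s), kA).

Definition read_S : C (seq 'I_kA) := fun s => (tabS s (cnt s), s, kA).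

Definition write_S (l : seq 'I_kA) : C unit :=
  fun s => (tt, Memory (cnt s) (tabV s)
                       (fun c => if c == cnt s then l else tabS s c), kA).

(* [tf c] is the time that it takes to compute [f c]. *)
Definition call_rule (f : count_rule R kA kB) (tf : counts kA -> nat) :
    C (mixed R kB) :=
  fun s => (f (cnt s), s, tf (cnt s)).

End Primitives.

Arguments get_cnt {R kA} i.
Arguments set_cnt {R kA} i n.
Arguments read_V {R kA}.
Arguments read_S {R kA}.
Arguments write_S {R kA} l.

Section Program.
Variables (R : realType) (kA kB T : nat) (G : game R kA kB).
Variables (f : count_rule R kA kB) (tf : counts kA -> nat).
Local Notation C := (timed R kA).
Local Notation best := (option (R * seq 'I_kA)).

Definition compute_mixed_utilA (i : 'I_kA) (beta : mixed R kB) : C R :=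
  foreach (enum 'I_kB) (fun j acc =>
    let* p := op (beta j) in
    let* u := op (utilA G i j) in
    let* pu := op (p * u) in
    op (acc + pu)) 0.

Definition keep_max (b : best) (w : R) (l : seq 'I_kA) : C best :=
  if b is Some (w0, _) then
    let* lt := op (w0 < w) in
    if lt then op (Some (w, l)) else op b
  else op (Some (w, l)).

(* Runs [body] with [cnt] set successively to every vector whose coordinates in
   [idx] sum to [s], the other coordinates being left unchanged. *)
Fixpoint foreach_counts Y (idx : seq 'I_kA) (s : nat)
    (body : Y -> C Y) (y : Y) : C Y :=
  match idx with
  | [::] => ret y
  | [:: i] =>
      let* _ := set_cnt i s in
      body y
  | i :: idx' =>
      foreach (iota 0 s.+1) (fun n z =>
        let* _ := set_cnt i n in
        let* r := op (s - n)%N in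
        foreach_counts idx' r body z) y
  end.

Definition init_table : C unit :=
  let* _ := foreach (enum 'I_kA) (fun i _ => set_cnt i 0) tt in
  foreach (enum 'I_kA) (fun i _ =>
    let* beta := call_rule f tf in
    let* v := compute_mixed_utilA i beta in
    let* l := op [:: i] in
    let* _ := set_cnt i 1 in
    let* _ := write_V v in
    let* _ := write_S l in
    set_cnt i 0) tt.

Definition fill_entry : C unit :=
  let* b := foreach (enum 'I_kA) (fun i b =>
    let* n := get_cnt i in
    let* pos := op (0 < n)%N in
    if pos then
      let* n' := op n.-1 in
      let* _ := set_cnt i n' in
      let* v := read_V in
      let* l := read_S in
      let* beta := call_rule f tf in
      let* u := compute_mixed_utilA i beta in
      let* w := op (v + u) in
      let* l' := op (i :: l) in
      let* _ := set_cnt i n in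
      keep_max b w l'
    else ret b) None in
  if b is Some (w, l) then
    let* _ := write_V w in
    write_S l
  else ret tt.

Definition fill_table : C unit :=
  foreach (iota 2 T.-1) (fun s _ =>
    foreach_counts (enum 'I_kA) s (fun _ => fill_entry) tt) tt.

Definition extract : C best :=
  let* b := foreach_counts (enum 'I_kA) T (fun b =>
    let* w := read_V in
    let* l := read_S in
    keep_max b w l) None in
  if b is Some (w, l) then
    let* x := foreach l (fun i r => op (i :: r)) [::] in
    ret (Some (w, x))
  else ret None.

Definition dynamic_program : C best :=
  let* _ := init_table in
  let* _ := fill_table in
  extract.

End Program.

(* Main.v *)
(* A sequence with counts c ends with some action i, and what precedes it has the
   counts c with c_i decreased; as the opponent's last mixed action depends on
   these counts only, V[c] is by induction the best payoff of a sequence with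
   counts c.  For the running time, there are 'C(T + k, k) count vectors of sum at
   most T, where k = kA, and 'C(T + k, k) <= 2 T^k if T >= 2; if T = 1, then the
   program only visits the k unit vectors. *)

Require Import Defs.
From mathcomp Require Import all_boot all_order all_algebra.
From mathcomp Require Import classical_sets reals zify.

Set Implicit Arguments.
Unset Strict Implicit.
Unset Printing Implicit Defensive.

Import Order.TTheory GRing.Theory Num.Theory.

Local Open Scope ring_scope.

(** * Count vectors *)

Section CountVectors.
Variable k : nat.
Implicit Types (c : counts k) (i : 'I_k) (x : seq 'I_k).

Lemma set_countsE c i n j : set_counts c i n j = if j == i then n else c j.
Proof. by rewrite ffunE. Qed.

Lemma set_counts_id c i : set_counts c i (c i) = c.
Proof. by apply/ffunP => j; rewrite set_countsE; case: eqP => // ->. Qed.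

Lemma set_counts_set c i n p :
  set_counts (set_counts c i n) i p = set_counts c i p.
Proof. by apply/ffunP => j; rewrite !set_countsE; case: eqP. Qed.

Lemma rounds_counts_of x : rounds (counts_of x) = size x.
Proof.
rewrite /rounds; elim: x => [|i x IHx]; first by rewrite big1 // => i _; rewrite ffunE.
rewrite (eq_bigr (fun j => (i == j) + counts_of x j)%N) => [|j _]; last by rewrite !ffunE.
rewrite big_split IHx /= (bigD1 i) //= eqxx big1 // => j.
by rewrite eq_sym => /negbTE->.
Qed.

Lemma counts_of_rcons x i :
  counts_of (rcons x i) = set_counts (counts_of x) i (counts_of x i).+1.
Proof.
apply/ffunP => j; rewrite !ffunE -cats1 count_cat /= addn0 eq_sym.
by case: eqP => [->|_]; rewrite ?addn1 ?addn0.
Qed.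

Lemma dec_set_counts c i : dec_counts (set_counts c i (c i).+1) i = c.
Proof. by rewrite /dec_counts set_countsE eqxx set_counts_set set_counts_id. Qed.

Lemma set_dec_counts c i :
  (0 < c i)%N -> set_counts (dec_counts c i) i (dec_counts c i i).+1 = c.
Proof.
by move=> ci; rewrite /dec_counts set_counts_set set_countsE eqxx prednK // set_counts_id.
Qed.

Lemma rounds_dec c i : (0 < c i)%N -> (rounds (dec_counts c i)).+1 = rounds c.
Proof.
move=> ci; rewrite /rounds (bigD1 i) //= [in RHS](bigD1 i) //= set_countsE eqxx -addSn prednK //.
by congr (_ + _)%N; apply: eq_bigr => j /negbTE ij; rewrite set_countsE ij.
Qed.

Lemma rounds_eq0 c : rounds c = 0%N -> c = zero_counts k.
Proof.
move=> /eqP; rewrite /rounds sum_nat_eq0 => /forallP c0.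
by apply/ffunP => i; rewrite ffunE; apply/eqP/(c0 i).
Qed.

Lemma rounds_gt0P c : (0 < rounds c)%N -> exists i, (0 < c i)%N.
Proof.
case: (pickP (fun i => (0 < c i)%N)) => [i ci _|c0]; first by exists i.
by rewrite /rounds big1 // => i _; apply/eqP; move: (c0 i); rewrite lt0n => /negbFE.
Qed.

Lemma rounds_eq1 c : rounds c = 1%N -> exists i, c = unit_counts i.
Proof.
move=> c1; have [|i ci] := @rounds_gt0P c; first by rewrite c1.
exists i; rewrite -[LHS](set_dec_counts ci) (@rounds_eq0 (dec_counts c i)).
  by rewrite /unit_counts ffunE.
by have := rounds_dec ci; rewrite c1 => -[].
Qed.

Lemma dec_unit_counts i : dec_counts (unit_counts i) i = zero_counts k.
Proof. by rewrite /dec_counts set_countsE eqxx set_counts_set -[RHS](set_counts_id _ i) ffunE. Qed.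

Lemma counts_of_nil : counts_of [::] = zero_counts k.
Proof. by apply/ffunP => i; rewrite !ffunE. Qed.

End CountVectors.

(** * Optimal sequences with prescribed counts *)

Section Optimal.
Variables (R : realType) (kA kB : nat).
Variables (G : game R kA kB) (f : count_rule R kA kB).
Implicit Types (c : counts kA) (i : 'I_kA) (x l : seq 'I_kA).

Lemma payoff_nil : payoff G f [::] = 0.
Proof. by rewrite /payoff big_ord0. Qed.

Lemma payoff_rcons x i :
  payoff G f (rcons x i) = payoff G f x + mixed_utilA G i (f (counts_of x)).
Proof.
have payoffE y : payoff G f y =
    \sum_(0 <= t < size y) mixed_utilA G (nth i y t) (f (counts_of (take t y))).
  by rewrite big_mkord; apply: eq_bigr => t _; rewrite (tnth_nth i).
rewrite !payoffE size_rcons big_nat_recr //= nth_rcons ltnn eqxx -cats1 take_size_cat //.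
congr (_ + _); rewrite !big_nat; apply: eq_bigr => t /= tx.
by rewrite nth_cat tx takel_cat // ltnW.
Qed.

(* [l] lists its actions last first, as in the array [tabS]. *)
Definition optimal_entry c (v : R) l :=
  [/\ counts_of (rev l) = c, payoff G f (rev l) = v
    & forall x, counts_of x = c -> payoff G f x <= v].

Lemma optimal_entry_cons c i v l (w := v + mixed_utilA G i (f (dec_counts c i))) :
  (0 < c i)%N -> optimal_entry (dec_counts c i) v l ->
  counts_of (rev (i :: l)) = c /\ payoff G f (rev (i :: l)) = w.
Proof.
move=> ci [lc lv _]; rewrite rev_cons counts_of_rcons payoff_rcons lc lv.
by rewrite set_dec_counts.
Qed.

(** A nonempty sequence with counts [c] ends with some [i], and its prefix, of counts
    [dec_counts c i], earns at most the optimum there. This one upper bound serves the initial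
    entries, an arbitrary table [V] and the entries written by the program. *)
Lemma payoff_le_step c w :
    (0 < rounds c)%N ->
    (forall i, (0 < c i)%N -> exists v l, optimal_entry (dec_counts c i) v l /\
       v + mixed_utilA G i (f (dec_counts c i)) <= w) ->
  forall x, counts_of x = c -> payoff G f x <= w.
Proof.
move=> c_gt0 H x xc; move: c_gt0; rewrite -xc rounds_counts_of.
case: (lastP x) xc => // y i; rewrite counts_of_rcons => yc _.
have [|v [l [[_ _ vmax] vw]]] := H i; first by rewrite -yc set_countsE eqxx.
move: vmax vw; rewrite -yc dec_set_counts => /(_ y erefl) yv.
by apply: le_trans; rewrite payoff_rcons lerD2r.
Qed.

Lemma optimal_entry_unit i :
  optimal_entry (unit_counts i) (mixed_utilA G i (f (zero_counts kA))) [:: i].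
Proof.
split; first by rewrite (counts_of_rcons [::]) counts_of_nil ffunE.
  by rewrite (payoff_rcons [::]) payoff_nil add0r counts_of_nil.
apply: payoff_le_step => [|j].
  by rewrite -(@rounds_dec _ _ i) // set_countsE eqxx.
rewrite set_countsE; case: eqP => [-> _|_]; last by rewrite ffunE.
(* The predecessor of a unit vector is the zero vector, outside the table; its optimal entry is the
   empty sequence with payoff 0. *)
exists 0, [::]; rewrite dec_unit_counts add0r; split=> //.
split=> [||x x0]; rewrite ?counts_of_nil ?payoff_nil //.
move: (rounds_counts_of x); rewrite x0 -counts_of_nil rounds_counts_of.
by case: (x) => // _; rewrite payoff_nil.
Qed.

Lemma optimal_entry_inj c v v' l l' :
  optimal_entry c v l -> optimal_entry c v' l' -> v = v'.
Proof.
move=> [lc lv vmax] [lc' lv' vmax']; apply/le_anti.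
by rewrite -{1}lv vmax' //= -lv' vmax.
Qed.

Lemma rounds_unit i : rounds (unit_counts i) = 1%N.
Proof.
by have [<- _ _] := optimal_entry_unit i; rewrite rounds_counts_of.
Qed.

(** Each candidate of the recurrence is the payoff of some sequence with counts [c], hence at most
    [V c]. The last action of [S c] attains the maximum, because the prefix before it earns at most
    the entry at its own counts. *)
Lemma optimal_is_dp_table T (V : counts kA -> R) (S : counts kA -> seq 'I_kA) :
    (0 < T)%N ->
    (forall c, (1 <= rounds c <= T)%N -> optimal_entry c (V c) (S c)) ->
  is_dp_table G f T V.
Proof.
move=> T_gt0 VS; split=> [i|c /andP[c2 cT]].
  by apply: optimal_entry_inj (VS _ _) (optimal_entry_unit i); rewrite rounds_unit.
have [|lc lv vmax] := VS c; first by rewrite cT ltnW.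
have VSdec i : (0 < c i)%N ->
    optimal_entry (dec_counts c i) (V (dec_counts c i)) (S (dec_counts c i)).
  by move=> ci; apply: VS; rewrite -(rounds_dec ci) ltnS in c2;
    rewrite c2 /= ltnW // rounds_dec.
split=> [|_ [i ci ->]]; last first.
  have [uc <-] := optimal_entry_cons ci (VSdec i ci); exact: vmax.
move: lc lv; rewrite -{1}(revK (S c)); case: (S c) => [|i l].
  by move=> /(congr1 (@rounds _)); rewrite rounds_counts_of; case: (rounds c) c2.
rewrite revK rev_cons => lc lv; exists i; first by rewrite -lc counts_of_rcons set_countsE eqxx.
have lc' : counts_of (rev l) = dec_counts c i by rewrite -lc counts_of_rcons dec_set_counts.
have ci : (0 < c i)%N by rewrite -lc counts_of_rcons set_countsE eqxx.
have [_ vle] := optimal_entry_cons ci (VSdec i ci).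
apply/le_anti; rewrite -[X in _ && (X <= _)]vle vmax; last first.
  by case: (optimal_entry_cons ci (VSdec i ci)).
rewrite andbT -lv payoff_rcons lc' lerD2r.
by case: (VSdec i ci) => _ _; apply.
Qed.

(** Strong induction on [rounds c]; the list is rebuilt by following maximizing indices back to a
    unit vector. *)
Lemma dp_table_optimal T (V : counts kA -> R) :
    is_dp_table G f T V ->
  forall c, (1 <= rounds c <= T)%N -> exists l, optimal_entry c (V c) l.
Proof.
move=> [V1 V2] c; have [n] := ubnP (rounds c).
elim: n c => // n IHn c; rewrite ltnS => cn /andP[c1 cT].
have [c2|] := leqP 2 (rounds c); last first.
  rewrite ltnS => c1'; have [|i ->] := @rounds_eq1 _ c; first by apply/anti_leq; rewrite c1'.
  by exists [:: i]; rewrite V1; apply: optimal_entry_unit.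
have IH i : (0 < c i)%N -> exists l, optimal_entry (dec_counts c i) (V (dec_counts c i)) l.
  by move=> /rounds_dec ci; apply: IHn; rewrite -ci in cn c2 cT *; rewrite ?cn // -ltnS c2 ltnW.
have [|[i ci Vc] ub] := V2 c; first by rewrite c2.
have [l il] := IH i ci; exists (i :: l).
have [lc lv] := optimal_entry_cons ci il; split; rewrite ?lv //.
apply: payoff_le_step => [|j cj]; first exact: ltnW.
by have [l' jl] := IH j cj; exists (V (dec_counts c j)), l'; split=> //; apply: ub; exists j.
Qed.

Lemma max_payoff_of_table T (V : counts kA -> R) :
    (0 < kA)%N -> (0 < T)%N ->
    (forall c, (1 <= rounds c <= T)%N -> exists l, optimal_entry c (V c) l) ->
  exists2 m, is_max [set v | exists2 c, rounds c = T & v = V c] m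
           & is_max [set p | exists x : T.-tuple 'I_kA, p = payoff G f x] m.
Proof.
move=> kA_gt0 T_gt0 VS.
pose x0 : T.-tuple 'I_kA := nseq_tuple T (Ordinal kA_gt0).
(* The sequences of length [T] form a finite type, so a best one exists; its payoff is the witness
   for both maxima. *)
case: (@Order.TotalTheory.arg_maxP _ _ _ x0 xpredT
  (fun x : T.-tuple 'I_kA => payoff G f x) isT) => x _ xmax.
have {}xmax (y : T.-tuple 'I_kA) : payoff G f y <= payoff G f x by apply: xmax.
have cT (y : T.-tuple 'I_kA) : rounds (counts_of y) = T by rewrite rounds_counts_of size_tuple.
have Vmax c : rounds c = T -> V c <= payoff G f x.
  move=> cT'; have [|l [lc <- _]] := VS c; first by rewrite cT' T_gt0 /=.
  have lT : size (rev l) == T by rewrite -rounds_counts_of lc cT'.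
  exact: (xmax (Tuple lT)).
exists (payoff G f x); split; [|by move=> _ [c cT' ->]; apply: Vmax| |].
- exists (counts_of x); rewrite ?cT //; apply/le_anti; rewrite Vmax ?cT // andbT.
  by have [|l [_ _]] := VS (counts_of x); rewrite ?cT ?T_gt0 //=; apply.
- by exists x.
- by move=> _ [y ->].
Qed.

End Optimal.

(** * Binomial bounds *)

(** Hockey-stick identity: ['C(m + k, k)] counts the vectors of [k + 1] coordinates with sum [m],
    and [p] is the value of one further coordinate. *)
Lemma sum_binomials n k :
  (\sum_(0 <= p < n.+1) 'C(n - p + k, k) = 'C(n + k.+1, k.+1))%N.
Proof.
elim: n => [|n IHn]; first by rewrite big_nat1 !binn.
by rewrite big_nat_recl // IHn subn0 [in RHS]addSn binS -addSnnS addnC.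
Qed.

(** Lets the overhead of a loop over the values [0..n] of one coordinate be charged to the vectors
    visited by that loop. *)
Lemma leq_binomial n k : (n < 'C(n + k.+1, k.+1))%N.
Proof.
elim: n => [|n IHn]; first by rewrite bin_gt0.
rewrite addSn binS -[n.+2]addn1 leq_add // bin_gt0; lia.
Qed.

(** From [k + 1] to [k + 2] the binomial grows by the factor (n + k + 2) / (k + 2), which is at most
    n as n >= 2. From 0 to 1 the factor is n + 1, hence the separate base case and the constant
    2. *)
Lemma binomial_le_exp n k : (1 < n)%N -> ('C(n + k, k) <= 2 * n ^ k)%N.
Proof.
move=> n_gt1; elim: k => [|[_|k IHk]]; first by rewrite bin0.
  by rewrite bin1 expn1; lia.
rewrite -(@leq_pmul2l k.+2) // -mul_bin_diag addnS /=.
apply: leq_trans (leq_mul (leqnn _) IHk) _.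
by rewrite [(n ^ k.+2)%N]expnS; move: (n ^ k.+1)%N => X; nia.
Qed.

(** This is the hockey-stick sum without its terms for 0 and 1; for [n = 1] it is empty. *)
Lemma sum_binomials_le_exp k n : (0 < k)%N -> (0 < n)%N ->
  (\sum_(m <- iota 2 n.-1) 'C(m + k.-1, k.-1) <= 2 * n ^ k)%N.
Proof.
case: k n => // k [//|[_ _|n _ _]]; first by rewrite big_nil.
apply: leq_trans (binomial_le_exp k.+1 (isT : 1 < n.+2)%N).
rewrite -sum_binomials big_nat_rev add0n
  (@eq_big_nat _ _ _ _ _ _ (fun m => 'C(m + k, k))).
  by rewrite 2?big_ltn //= addnA leq_addl.
by move=> m m_le; congr 'C(_ + k, k); lia.
Qed.

(** The factor [k] comes from [n = 1], where the binomial equals [k]. It is affordable because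
    extraction spends only O(kA) on each vector. *)
Lemma binomial_le_mul_exp k n : (0 < k)%N -> (0 < n)%N ->
  ('C(n + k.-1, k.-1) <= 2 * k * n ^ k)%N.
Proof.
case: k n => // k [//|[_ _|n _ _]].
  by rewrite exp1n add1n binSn; lia.
apply: leq_trans (binomial_le_exp k (isT : 1 < n.+2)%N) _ => /=.
by rewrite expnS; move: (n.+2 ^ k)%N => X; nia.
Qed.

(** * A program logic for the cost model *)

(** Weakest precondition; programs are total functions, so termination is automatic, and the elapsed
    time is an argument of the postcondition. *)
Definition wp (R : realType) (kA : nat) X (m : timed R kA X) (s : memory R kA)
    (Q : X -> memory R kA -> nat -> Prop) : Prop :=
  let: (x, s', t) := m s in Q x s' t.

Section Logic.
Variables (R : realType) (kA : nat).
Implicit Types (X Y : Type) (s : memory R kA) (t b B : nat).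

Lemma wp_mono X (m : timed R kA X) s (Q Q' : X -> memory R kA -> nat -> Prop) :
  wp m s Q -> (forall x s' t, Q x s' t -> Q' x s' t) -> wp m s Q'.
Proof. by rewrite /wp; case: (m s) => [[x s'] t] Qx; apply. Qed.

Lemma wp_bind X Y (m : timed R kA X) (k : X -> timed R kA Y) s Q :
  wp m s (fun x s1 t1 => wp (k x) s1 (fun y s2 t2 => Q y s2 (t1 + t2)%N)) ->
  wp (bind m k) s Q.
Proof.
rewrite /wp /bind; case: (m s) => [[x s1] t1].
by case: (k x s1) => [[y s2] t2].
Qed.

Lemma wp_op X (x : X) s (Q : X -> memory R kA -> nat -> Prop) :
  Q x s 1%N -> wp (op x) s Q.
Proof. by []. Qed.

Lemma wp_set_cnt i n s (Q : unit -> memory R kA -> nat -> Prop) :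
  Q tt (Memory (set_counts (cnt s) i n) (tabV s) (tabS s)) 1%N ->
  wp (set_cnt i n) s Q.
Proof. by []. Qed.

(** The invariant is indexed by the list of elements already processed. Every iteration pays one
    unit for its loop test, and the exit pays one more. *)
Lemma wp_foreach X Y (l : seq X) (body : X -> Y -> timed R kA Y)
    (I : seq X -> Y -> memory R kA -> Prop) (b : X -> nat) y s :
    (forall d x r y s, l = d ++ x :: r -> I d y s ->
       wp (body x y) s (fun y' s' t => I (rcons d x) y' s' /\ (t <= b x)%N)) ->
    I [::] y s ->
  wp (foreach l body y) s (fun y' s' t =>
    I l y' s' /\ (t <= (\sum_(x <- l) (b x).+1).+1)%N).
Proof.
move=> Hbody.
suff H r d y' s' : l = d ++ r -> I d y' s' ->
    wp (foreach r body y') s' (fun y' s' t =>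
      I l y' s' /\ (t <= (\sum_(x <- r) (b x).+1).+1)%N) by exact: H.
elim: r d y' s' => [|x r IHr] d y' s' ldr Id.
  by rewrite big_nil /wp /= ldr cats0.
apply: wp_bind; apply: wp_bind.
apply: wp_mono (Hbody _ _ _ _ _ ldr Id) _ => y1 s1 t1 [Id1 t1b].
apply: wp_mono (IHr (rcons d x) _ _ _ Id1) _; first by rewrite cat_rcons.
by move=> y2 s2 t2 [Il t2b]; split=> //; rewrite big_cons; lia.
Qed.

(* [D] lists the count vectors already visited.  The loop runs [body] on
   'C(n + k - 1, k - 1) vectors for k = size (i :: idx), and its own overhead is
   at most 4 k for each of them. *)
Lemma wp_foreach_counts Y (body : Y -> timed R kA Y) (ok : pred (counts kA))
    (I : seq (counts kA) -> Y -> memory R kA -> Prop) B :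
    (forall D y c V S, I D y (Memory c V S) -> forall c', I D y (Memory c' V S)) ->
    (forall D y s, I D y s -> ok (cnt s) ->
       wp (body y) s (fun y' s' t =>
         [/\ I (cnt s :: D) y' s', cnt s' = cnt s & (t <= B)%N])) ->
  forall i idx n D y s, uniq (i :: idx) -> I D y s ->
    (forall c : counts kA, (forall j, j \notin i :: idx -> c j = cnt s j) ->
       (\sum_(j <- i :: idx) c j)%N = n -> ok c) ->
  wp (foreach_counts (i :: idx) n body y) s (fun y' s' t => exists D',
    [/\ I D' y' s', {subset D <= D'},
        forall j, j \notin i :: idx -> cnt s' j = cnt s j,
        forall c : counts kA, (forall j, j \notin i :: idx -> c j = cnt s j) ->
          (\sum_(j <- i :: idx) c j)%N = n -> c \in D'
      & (t <= 'C(n + size idx, size idx) * (4 * (size idx).+1 + B))%N]).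
Proof.
move=> Icnt Hbody i idx; elim: idx i => [|i' idx IHidx] i n D y s.
  move=> _ Is Hok; apply: wp_bind; apply: wp_set_cnt.
  set s1 := Memory _ _ _.
  have s1_ok : ok (cnt s1).
    apply: Hok => [j|] /=; rewrite ?big_seq1 set_countsE ?eqxx //.
    by rewrite inE => /negbTE->.
  (* By [Icnt] the invariant is insensitive to the working vector, so setting a coordinate preserves
     it. *)
  have Is1 : I D y s1 by case: (s) Is @s1 {s1_ok} => c V S Is; apply: Icnt Is _.
  apply: wp_mono (Hbody _ _ _ Is1 s1_ok) _ => y' s' t [Is' cnt_s' tB].
  exists (cnt s1 :: D); split=> //.
  - by move=> c cD; rewrite inE cD orbT.
  - by move=> j; rewrite inE cnt_s' set_countsE => /negbTE->.
  - move=> c cs; rewrite big_seq1 => ci; rewrite inE; apply/orP; left; apply/eqP/ffunP => j.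
    by rewrite set_countsE; case: eqP => [->//|/eqP ij]; apply: cs; rewrite inE.
  - by rewrite /= bin0; lia.
rewrite cons_uniq => /andP[i_idx uniq_idx] Is Hok.
(* After the values [d] of coordinate [i], the target vectors whose coordinate [i] lies in [d] have
   all been visited. *)
pose J (d : seq nat) (z : Y) (s' : memory R kA) := exists D',
  [/\ I D' z s', {subset D <= D'},
      forall j, j \notin [:: i, i' & idx] -> cnt s' j = cnt s j
    & forall c : counts kA, (forall j, j \notin [:: i, i' & idx] -> c j = cnt s j) ->
          (\sum_(j <- [:: i, i' & idx]) c j)%N = n -> c i \in d -> c \in D'].
(* The 2 pays for [set_cnt] and the subtraction; the rest is the inductive bound. *)
pose b p := (2 + 'C(n - p + size idx, size idx) * (4 * (size idx).+1 + B))%N.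
have J0 : J [::] y s by exists D; split.
rewrite (_ : foreach_counts _ _ _ _ = foreach (iota 0 n.+1) (fun p z =>
  let* _ := set_cnt i p in
  let* r := op (n - p)%N in foreach_counts (i' :: idx) r body z) y) //.
apply: wp_mono (wp_foreach (I := J) (b := b) _ J0) _; last first.
  move=> y' s' t [[D' [Is' DD' cs' HD'] tb]]; exists D'; split=> //.
    move=> c cs cn; apply: HD' => //; rewrite mem_iota /= -cn big_cons; lia.
  apply: leq_trans tb _; rewrite -[iota 0 n.+1]/(index_iota 0 n.+1) /b.
  under eq_bigr do rewrite -addSn.
  rewrite big_split sum_nat_const_nat -big_distrl /= sum_binomials subn0.
  rewrite [(4 * (size idx).+2)%N]mulnS -[X in (_ < _ * X)%N]addnA [X in (_ < X)%N]mulnDr.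
  (* The loop itself costs 3 (n + 1) + 1, at most four times the number of visited vectors: this is
     the extra 4 allowed for one more coordinate. *)
  by have := leq_binomial n (size idx); move: 'C(_, _) (_ * (_ + B))%N => C M; lia.
move=> d p r z s1 dpr [D1 [Is1 DD1 cs1 HD1]].
have pn : (p < n.+1)%N by have := mem_iota 0 n.+1 p; rewrite dpr mem_cat inE eqxx orbT.
apply: wp_bind; apply: wp_set_cnt; set s2 := Memory _ _ _.
apply: wp_bind; apply: wp_op.
have Is2 : I D1 z s2 by case: (s1) Is1 @s2 => c V S Is1'; apply: Icnt Is1' _.
have sub_notin j : j \notin [:: i, i' & idx] -> j \notin i' :: idx.
  by rewrite inE negb_or => /andP[].
have s2_out j : j \notin [:: i, i' & idx] -> cnt s2 j = cnt s j.
  by move=> jidx; rewrite set_countsE; case: eqP => [ji|_];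
    [rewrite ji mem_head in jidx|apply: cs1].
have lift_c (c : counts kA) : (forall j, j \notin i' :: idx -> c j = cnt s2 j) ->
  (\sum_(j <- i' :: idx) c j)%N = (n - p)%N ->
  (forall j, j \notin [:: i, i' & idx] -> c j = cnt s j) /\
  (\sum_(j <- [:: i, i' & idx]) c j)%N = n.
  move=> cs2 cnp; split; first by move=> j jidx; rewrite cs2 ?s2_out ?sub_notin.
  by rewrite big_cons cnp cs2 // set_countsE eqxx subnKC.
apply: wp_mono (IHidx i' (n - p)%N D1 z s2 uniq_idx Is2 _) _.
  by move=> c cs2 cnp; have [] := lift_c c cs2 cnp; apply: Hok.
move=> y' s' t [D' [Is' D1D' s'_out HD' tb]]; split; last by rewrite /b; lia.
exists D'; split=> //.
- by move=> c /DD1 /D1D'.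
- by move=> j jidx; rewrite s'_out ?s2_out ?sub_notin.
move=> c cs cn; rewrite mem_rcons inE => /orP[/eqP cp|cd]; last by apply/D1D'/HD1.
apply: HD' => [j jidx|]; last by move: cn; rewrite big_cons cp => <-; rewrite addKn.
rewrite set_countsE; case: eqP => [->//|/eqP ji].
by rewrite cs ?cs1 // inE negb_or ji.
Qed.

End Logic.

(** * Correctness and cost of the program *)

Section Program.
Variables (R : realType) (kA kB T C0 : nat) (G : game R kA kB).
Variables (f : count_rule R kA kB) (tf : counts kA -> nat).
Hypothesis tf_le : forall c, (tf c <= C0 * (kA * kB))%N.
Hypotheses (kA_gt0 : (0 < kA)%N) (kB_gt0 : (0 < kB)%N) (T_gt0 : (0 < T)%N).
Implicit Types (s : memory R kA) (c : counts kA) (i : 'I_kA).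

Let kAB_ge : (kA <= kA * kB)%N /\ (kB <= kA * kB)%N.
Proof. by split; [apply: leq_pmulr | apply: leq_pmull]. Qed.

(** Each action of $B$ costs four operations and a loop test; the last unit is the test that ends
    the loop. *)
Lemma wp_compute_mixed_utilA i beta s :
  wp (compute_mixed_utilA G i beta) s (fun v s' t =>
    [/\ v = mixed_utilA G i beta, s' = s & (t <= 5 * kB + 1)%N]).
Proof.
pose I (d : seq 'I_kB) (v : R) s' :=
  v = \sum_(j <- d) beta j * utilA G i j /\ s' = s.
apply: wp_mono (wp_foreach (I := I) (b := fun=> 4) _ _) _; last 2 first.
- by rewrite /I big_nil.
- move=> v s' t [[-> ->] tb]; split=> //; first by rewrite /mixed_utilA big_enum.
  by move: tb; rewrite big_const_seq count_predT size_enum_ord iter_addn addn0; lia.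
move=> d j r v _ _ [-> ->]; do 4 (try apply: wp_bind); rewrite /wp /=.
by split=> //; split=> //; rewrite -cats1 big_cat big_seq1.
Qed.

(** The disjunction carries over that the kept value is attained by its list; the last clause
    carries over the upper bound on earlier candidates. *)
Lemma wp_keep_max b (w : R) (l : seq 'I_kA) s :
  wp (keep_max b w l) s (fun b' s' t =>
    [/\ s' = s, (t <= 2)%N, b' = b \/ b' = Some (w, l)
      & exists v l', [/\ b' = Some (v, l'), w <= v
          & forall v0 l0, b = Some (v0, l0) -> v0 <= v]]).
Proof.
case: b => [[w0 l0]|] /=; last first.
  by rewrite /wp /=; split=> //; [right|exists w, l].
apply: wp_bind; apply: wp_op; case: (ltP w0 w) => w0w; rewrite /wp /=; split=> //.
- by right.
- by exists w, l; split=> // v0 l' [<- _]; apply: ltW.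
- by left.
- by exists w0, l0; split=> // v0 l' [<- _].
Qed.

Lemma wp_init_table s :
  wp (init_table G f tf) s (fun _ s' t =>
    (forall c, rounds c = 1%N -> optimal_entry G f c (tabV s' c) (tabS s' c)) /\
    (t <= (C0 + 20) * (kA * (kA * kB)))%N).
Proof.
apply: wp_bind.
(* The first loop clears the working vector, whose initial content is arbitrary. *)
pose I1 (d : seq 'I_kA) (_ : unit) s' := forall j, j \in d -> cnt s' j = 0%N.
apply: wp_mono (wp_foreach (I := I1) (b := fun=> 1) _ _) _; last 2 first.
- by [].
- move=> [] s1 t1 [I1s1 t1b].
  have cnt0 : cnt s1 = zero_counts kA.
    by apply/ffunP => j; rewrite ffunE I1s1 // mem_enum.
  (* Each pass restores the zero vector, so the rule is always called at zero counts. *)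
  pose I2 (d : seq 'I_kA) (_ : unit) s' := cnt s' = zero_counts kA /\
    forall j (c := unit_counts j), j \in d -> optimal_entry G f c (tabV s' c) (tabS s' c).
  (* One rule call, one expected utility, two table writes of [kA] units each and three elementary
     operations. *)
  apply: wp_mono (wp_foreach (I := I2)
    (b := fun=> (C0 * (kA * kB) + 5 * kB + 2 * kA + 4)%N) _ _) _.
  + move=> d i r [] s2 _ [cnt2 opt2]; apply: wp_bind; rewrite {1}/wp /call_rule cnt2.
    apply: wp_bind; apply: wp_mono (wp_compute_mixed_utilA _ _ _) _ => _ _ t2 [-> -> t2b].
    apply: wp_bind; apply: wp_op; apply: wp_bind; apply: wp_set_cnt.
    rewrite /wp /= cnt2 set_counts_set; split; last first.
      by have := tf_le (zero_counts kA); lia.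
    split=> /=; first by rewrite -[RHS](set_counts_id _ i) ffunE.
    move=> j; rewrite mem_rcons inE -/(unit_counts i) => /orP[/eqP ->|jd].
      by rewrite eqxx; apply: optimal_entry_unit.
    by case: eqP => [->|_]; [apply: optimal_entry_unit | apply: opt2].
  + by split.
  + move=> [] s2 t2 [[_ opt2] t2b]; split.
      by move=> c /rounds_eq1[i ->]; apply: opt2; rewrite mem_enum.
    move: t1b t2b; rewrite !big_const_seq !count_predT !size_enum_ord !iter_addn !addn0.
    case: kAB_ge; set P := (kA * kB)%N => kP bP t1b t2b.
    nia.
move=> d i r [] s1 _ I1s1; apply: wp_set_cnt; split=> // j.
by rewrite mem_rcons inE set_countsE; case: eqP => //= _; apply: I1s1.
Qed.

Lemma wp_fill_entry s :
    (1 < rounds (cnt s))%N ->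
    (forall c, (rounds c).+1 = rounds (cnt s) ->
       optimal_entry G f c (tabV s c) (tabS s c)) ->
  wp (fill_entry G f tf) s (fun _ s' t =>
    [/\ cnt s' = cnt s,
        forall c, c != cnt s -> tabV s' c = tabV s c /\ tabS s' c = tabS s c,
        optimal_entry G f (cnt s) (tabV s' (cnt s)) (tabS s' (cnt s))
      & (t <= (C0 + 25) * (kA * (kA * kB)))%N]).
Proof.
set c := cnt s => c_gt1 opt_s.
pose val i := tabV s (dec_counts c i) + mixed_utilA G i (f (dec_counts c i)).
(* The kept value is the payoff of a genuine sequence with counts [c] and dominates the candidates
   [val i] seen so far. The memory is [s] again after each pass, which undoes its decrement. *)
pose I (d : seq 'I_kA) (b : option (R * seq 'I_kA)) s' :=
  [/\ s' = s,
      forall w l, b = Some (w, l) -> counts_of (rev l) = c /\ payoff G f (rev l) = w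
    & forall i, i \in d -> (0 < c i)%N ->
        exists w l, b = Some (w, l) /\ val i <= w].
have opt_dec i : (0 < c i)%N -> let c' := dec_counts c i in
    optimal_entry G f c' (tabV s c') (tabS s c').
  by move=> ci; apply: opt_s; rewrite rounds_dec.
(* A rule call, an expected utility in [5 * kB + 1], two table reads, and nine further units, two of
   them for [keep_max]. *)
pose time_i := (C0 * (kA * kB) + 5 * kB + 2 * kA + 10)%N.
apply: wp_bind; apply: wp_mono (wp_foreach (I := I) (b := fun=> time_i) _ _) _; last 2 first.
- by split.
- move=> b _ t [[-> b_attained b_max] tb].
  (* A positive coordinate exists, so some candidate was considered and [b] is not [None]. *)
  have [i ci] := rounds_gt0P (ltnW c_gt1).
  have [|w [l [bE _]]] := b_max i _ ci; first by rewrite mem_enum.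
  subst b; have [lc lw] := b_attained w l erefl.
  rewrite /wp /= eqxx; split=> //.
  + by move=> c' /negbTE->.
  + split=> //; apply: payoff_le_step => [|j cj]; first exact: ltnW.
    exists (tabV s (dec_counts c j)), (tabS s (dec_counts c j)); split; first exact: opt_dec.
    by have [|_ [_ [[<- _]]]] := b_max j _ cj; first by rewrite mem_enum.
  + move: tb; rewrite big_const_seq count_predT size_enum_ord iter_addn addn0 /time_i.
    case: kAB_ge; set P := (kA * kB)%N => kP bP tb.
    nia.
move=> d i r b s1 _ [-> b_attained b_max].
apply: wp_bind; rewrite {1}/wp /get_cnt -/c; apply: wp_bind; apply: wp_op.
case: posnP => ci /=.
  rewrite /wp /=; split; last by rewrite /time_i; lia.
  split=> // j; rewrite mem_rcons inE.
  by case/orP => [/eqP ->|jd]; [rewrite ci | apply: b_max].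
apply: wp_bind; apply: wp_op; apply: wp_bind; apply: wp_set_cnt; rewrite -/c -/(dec_counts c i).
apply: wp_bind; rewrite {1}/wp /read_V /=; apply: wp_bind; rewrite {1}/wp /read_S /=.
apply: wp_bind; rewrite {1}/wp /call_rule /=; apply: wp_bind.
apply: wp_mono (wp_compute_mixed_utilA _ _ _) _ => _ _ t1 [-> -> t1b].
apply: wp_bind; apply: wp_op; apply: wp_bind; apply: wp_op.
apply: wp_bind; apply: wp_set_cnt => /=.
rewrite set_counts_set set_counts_id.
have -> : Memory c (tabV s) (tabS s) = s by rewrite /c; case: (s).
apply: wp_mono (wp_keep_max _ _ _ _) _ => b' _ t2 [-> t2b b'E [w [l [b'_some le_w le_b]]]].
split; last by have := tf_le (dec_counts c i); rewrite /time_i; lia.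
split=> //.
  move=> w' l' b'E'; case: b'E => [bb'|]; first by apply: b_attained; rewrite -bb'.
  rewrite b'E' => -[-> ->]; exact: optimal_entry_cons (opt_dec i ci).
move=> j; rewrite mem_rcons inE => /orP[/eqP ->|jd] cj; exists w, l; split=> //.
by have [w0 [l0 [bE]]] := b_max j jd cj; move/le_trans; apply; apply: le_b bE.
Qed.

(** When all coordinates are enumerated none is frozen, so the agreement condition is void and every
    vector of sum [n] is visited. *)
Lemma wp_foreach_all_counts Y (body : Y -> timed R kA Y) n
    (I : seq (counts kA) -> Y -> memory R kA -> Prop) B y s :
    (forall D y c V S, I D y (Memory c V S) -> forall c', I D y (Memory c' V S)) ->
    (forall D y s, I D y s -> rounds (cnt s) = n ->
       wp (body y) s (fun y' s' t =>
         [/\ I (cnt s :: D) y' s', cnt s' = cnt s & (t <= B)%N])) ->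
    I [::] y s ->
  wp (foreach_counts (enum 'I_kA) n body y) s (fun y' s' t =>
    (exists D, I D y' s' /\ forall c, rounds c = n -> c \in D) /\
    (t <= 'C(n + kA.-1, kA.-1) * (4 * kA + B))%N).
Proof.
move=> Icnt Hbody Is.
have roundsE c : rounds c = (\sum_(j <- enum 'I_kA) c j)%N by rewrite big_enum.
move: roundsE (size_enum_ord kA) (enum_uniq 'I_kA) (mem_enum 'I_kA).
case: (enum 'I_kA) => [_ kA0|i idx roundsE size_idx uniq_idx mem_idx].
  by case/negP: (lt0n_neq0 kA_gt0); rewrite -[X in X == _]kA0.
have size_idx' : size idx = kA.-1 := congr1 predn size_idx.
apply: wp_mono (wp_foreach_counts (ok := fun c => rounds c == n) Icnt _ uniq_idx Is _) _.
- by move=> D y' s' Is' /eqP; apply: Hbody.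
- by move=> c _ cn; rewrite roundsE cn.
move=> y' s' t [D [Is' _ _ HD]]; rewrite size_idx' prednK // => tb; split=> //.
exists D; split=> // c cn; apply: HD => [j|]; last by rewrite -roundsE.
by rewrite mem_idx.
Qed.

(** An entry of sum n reads only entries of sum n - 1, which are complete when pass n begins. *)
Lemma wp_fill_table s :
    (forall c, rounds c = 1%N -> optimal_entry G f c (tabV s c) (tabS s c)) ->
  wp (fill_table T G f tf) s (fun _ s' t =>
    (forall c, (1 <= rounds c <= T)%N -> optimal_entry G f c (tabV s' c) (tabS s' c)) /\
    (t <= (\sum_(n <- iota 2 T.-1)
             ('C(n + kA.-1, kA.-1) * (4 * kA + (C0 + 25) * (kA * (kA * kB)))).+1).+1)%N).
Proof.
move=> opt1.
pose I (d : seq nat) (_ : unit) s' := forall c, (1 <= rounds c <= (size d).+1)%N ->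
  optimal_entry G f c (tabV s' c) (tabS s' c).
pose b n := ('C(n + kA.-1, kA.-1) * (4 * kA + (C0 + 25) * (kA * (kA * kB))))%N.
apply: wp_mono (wp_foreach (I := I) (b := b) _ _) _; last 2 first.
- by move=> c /andP[c1 c2]; apply/opt1/anti_leq; rewrite c1 c2.
- by move=> [] s' t []; rewrite /I size_iota prednK.
move=> d n r [] s1 dnr opt_d.
(* The passes run through 2, 3, ..., hence the offset 2. *)
have nE : n = (size d).+2.
  have := congr1 (nth 0%N ^~ (size d)) dnr; rewrite nth_cat ltnn subnn /= nth_iota //.
  by have := congr1 size dnr; rewrite size_iota size_cat /=; lia.
(* Within a pass, entries of smaller sum stay correct and the visited ones have become correct. *)
pose J (D : seq (counts kA)) (_ : unit) s' := forall c,
  (1 <= rounds c <= (size d).+1)%N || (c \in D) ->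
  optimal_entry G f c (tabV s' c) (tabS s' c).
apply: wp_mono (wp_foreach_all_counts (I := J) (B := ((C0 + 25) * (kA * (kA * kB)))%N) _ _ _) _.
- by [].
- move=> D [] s2 opt_D c2; apply: wp_mono (wp_fill_entry _ _) _.
  + by rewrite c2 nE.
  + by move=> c; rewrite c2 nE => -[cd]; apply: opt_D; rewrite cd ltnSn.
  move=> [] s3 t [-> same opt_new tb]; split=> // c.
  rewrite inE; have [-> //|c_neq /=] := eqVneq c (cnt s2).
  by have [-> ->] := same c c_neq; apply: opt_D.
- by move=> c; rewrite orbF; apply: opt_d.
move=> [] s2 t [[D [opt_D all_D]] tb]; split=> // c; rewrite size_rcons -nE => /andP[c1 cn].
apply: opt_D; have [c_eq|c_neq] := eqVneq (rounds c) n; first by rewrite all_D ?orbT.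
by apply/orP; left; lia.
Qed.

Lemma wp_extract s :
    (forall c, rounds c = T -> size (tabS s c) = T) ->
  wp (extract T) s (fun out s' t => exists c,
    [/\ out = Some (tabV s c, rev (tabS s c)), rounds c = T,
        forall c', rounds c' = T -> tabV s c' <= tabV s c,
        tabV s' = tabV s /\ tabS s' = tabS s
      & (t <= 'C(T + kA.-1, kA.-1) * (4 * kA + (2 * kA + 2)) + (2 * T + 1))%N]).
Proof.
move=> sizeS.
pose I (D : seq (counts kA)) (b : option (R * seq 'I_kA)) s' :=
  [/\ tabV s' = tabV s, tabS s' = tabS s,
      forall w l, b = Some (w, l) ->
        exists c, [/\ rounds c = T, w = tabV s c & l = tabS s c]
    & forall c, c \in D -> exists w l, b = Some (w, l) /\ tabV s c <= w].
apply: wp_bind.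
apply: wp_mono (wp_foreach_all_counts (I := I) (B := (2 * kA + 2)%N) _ _ _) _.
- by [].
- move=> D b s1 [V1 S1 b_attained b_max] c1.
  apply: wp_bind; rewrite {1}/wp /read_V; apply: wp_bind; rewrite {1}/wp /read_S.
  apply: wp_mono (wp_keep_max _ _ _ _) _ => b' _ t [-> tb b'E [w [l [b'_some le_w le_b]]]].
  split=> //; last by lia.
  split=> //.
    move=> w' l'; case: b'E => [->|->]; first exact: b_attained.
    by move=> [<- <-]; exists (cnt s1); rewrite V1 S1.
  move=> c; rewrite inE => /orP[/eqP ->|cD]; exists w, l; split=> //; first by rewrite -V1.
  by have [w0 [l0 [bE]]] := b_max c cD; move/le_trans; apply; apply: le_b bE.
- by [].
move=> b s1 t [[D [[V1 S1 b_attained b_max] all_D]] tb].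
(* Playing the first action [T] times gives a vector of sum [T], so some entry was compared and [b]
   is not [None]. *)
pose c0 := counts_of (nseq T (Ordinal kA_gt0)).
have [|w [l [bE _]]] := b_max c0; first by rewrite all_D // rounds_counts_of size_nseq.
subst b; have [c [cT wc lc]] := b_attained w l erefl.
apply: wp_bind.
(* Stored lists have the last action first; copying onto an accumulator restores chronological
   order. *)
apply: wp_mono (wp_foreach (I := fun d r s' => r = rev d /\ s' = s1) (b := fun=> 1) _ _) _.
- by move=> d i r x _ _ [-> ->]; rewrite /wp /= rev_rcons.
- by [].
move=> x s2 t2 [[-> ->] t2b]; exists c; rewrite /wp /= -wc -lc; split=> //.
  by move=> c' c'T; have [|w' [l' [[<- _]]]] := b_max c'; first exact: all_D.
move: t2b; rewrite lc big_const_seq count_predT iter_addn sizeS //; lia.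
Qed.

(** In units of [kA ^ 2 * kB * T ^ kA], initialization costs at most C0 + 20, filling 2 C0 + 59 and
    extraction 19. *)
Lemma time_bound :
  ((C0 + 20) * (kA * (kA * kB)) +
   ((\sum_(n <- iota 2 T.-1)
      ('C(n + kA.-1, kA.-1) * (4 * kA + (C0 + 25) * (kA * (kA * kB)))).+1).+1 +
   ('C(T + kA.-1, kA.-1) * (4 * kA + (2 * kA + 2)) + (2 * T + 1)))
  <= (3 * C0 + 100) * (kA ^ 2 * kB * T ^ kA))%N.
Proof.
have sumE B : (\sum_(n <- iota 2 T.-1) ('C(n + kA.-1, kA.-1) * B).+1 =
    T.-1 + (\sum_(n <- iota 2 T.-1) 'C(n + kA.-1, kA.-1)) * B)%N.
  under eq_bigr do rewrite -add1n.
  by rewrite big_split big_const_seq count_predT size_iota iter_addn mul1n addn0 -big_distrl.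
rewrite sumE; move: (sum_binomials_le_exp kA_gt0 T_gt0) (binomial_le_mul_exp kA_gt0 T_gt0).
set S := (\sum_(n <- _) _)%N; set N := 'C(_, _) => S_le N_le.
have X_ge : (T <= T ^ kA)%N by rewrite -{1}[T]expn1 leq_pexp2l.
set X := (T ^ kA)%N in S_le N_le X_ge *.
have -> : (kA ^ 2 * kB * X = kA * (kA * kB) * X)%N by rewrite expnS expn1 !mulnA.
set Q := (kA * (kA * kB))%N.
have kkQ : (kA * kA <= Q)%N by rewrite leq_mul2l; case: kAB_ge => ->; rewrite orbT.
have kkk : (kA <= kA * kA)%N by rewrite leq_pmulr.
have Q_gt0 : (0 < Q)%N by lia.
have h1 : (X <= Q * X)%N by rewrite leq_pmull.
have h2 : (Q <= Q * X)%N by rewrite leq_pmulr //; lia.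
have h3 : (kA * X <= Q * X)%N by rewrite leq_mul2r (leq_trans kkk kkQ) orbT.
have h4 : (kA * kA * X <= Q * X)%N by rewrite leq_mul2r kkQ orbT.
have h5 : (S * (4 * kA + (C0 + 25) * Q) <= 2 * X * (4 * kA + (C0 + 25) * Q))%N.
  by rewrite leq_mul2r S_le orbT.
have h6 : (N * (4 * kA + (2 * kA + 2)) <= 2 * kA * X * (4 * kA + (2 * kA + 2)))%N.
  by rewrite leq_mul2r N_le orbT.
have h7 : (C0 * Q <= C0 * (Q * X))%N by rewrite leq_mul2l h2 orbT.
move: h1 h2 h3 h4 h5 h6 h7; lia.
Qed.

Lemma wp_dynamic_program s :
  wp (dynamic_program T G f tf) s (fun out s' t => exists c,
    [/\ forall c, (1 <= rounds c <= T)%N -> optimal_entry G f c (tabV s' c) (tabS s' c),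
        (t <= (3 * C0 + 100) * (kA ^ 2 * kB * T ^ kA))%N, rounds c = T,
        out = Some (tabV s' c, rev (tabS s' c))
      & forall c', rounds c' = T -> tabV s' c' <= tabV s' c]).
Proof.
apply: wp_bind; apply: wp_mono (wp_init_table s) _ => _ s1 t1 [opt1 t1b].
apply: wp_bind; apply: wp_mono (wp_fill_table opt1) _ => _ s2 t2 [opt2 t2b].
apply: wp_mono (wp_extract _) _ => [c cT|out s3 t3 [c [outE cT cmax [-> ->] t3b]]].
  have [|lc _ _] := opt2 c; first by rewrite cT T_gt0 /=.
  by rewrite -size_rev -rounds_counts_of lc.
exists c; split=> //; apply: leq_trans time_bound.
by rewrite leq_add // leq_add.
Qed.

End Program.

(** [C0] is the constant in the O(k_A k_B) time of a rule call; [K] depends on it alone and is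
    uniform in the game, the horizon and the rule. *)
Theorem theorem1 (C0 : nat) :
  exists K : nat,
  forall (R : realType) (kA kB T : nat) (G : game R kA kB)
    (f : count_rule R kA kB) (tf : counts kA -> nat) (s0 : memory R kA),
  (0 < kA)%N -> (0 < kB)%N -> (0 < T)%N ->
  (forall c, (tf c <= C0 * (kA * kB))%N) ->
  let is_max_payoff :=
    is_max [set p | exists x : T.-tuple 'I_kA, p = payoff G f x] in
  (forall V : counts kA -> R, is_dp_table G f T V ->
     exists2 m, is_max [set v | exists2 c, rounds c = T & v = V c] m
              & is_max_payoff m)
  /\
  let: (out, s, time) := dynamic_program T G f tf s0 in
  [/\ is_dp_table G f T (tabV s),
      (time <= K * (kA ^ 2 * kB * T ^ kA))%N,
      forall c, (1 <= rounds c <= T)%N ->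
        counts_of (rev (tabS s c)) = c /\
        payoff G f (rev (tabS s c)) = tabV s c
    & exists2 x : T.-tuple 'I_kA,
        out = Some (payoff G f x, tval x) & is_max_payoff (payoff G f x)].
Proof.
exists (3 * C0 + 100)%N => R kA kB T G f tf s0 kA_gt0 kB_gt0 T_gt0 tf_le is_max_payoff.
split=> [V /dp_table_optimal|]; first exact: max_payoff_of_table.
have := wp_dynamic_program G f tf_le kA_gt0 kB_gt0 T_gt0 s0; rewrite /wp.
case: (dynamic_program _ _ _ _ _) => [[out s] time] [c [opt tb cT outE cmax]].
have [|lc lV _] := opt c; first by rewrite cT T_gt0 /=.
have size_l : size (rev (tabS s c)) == T by rewrite -rounds_counts_of lc cT.
split=> //.
- exact: optimal_is_dp_table opt.
- by move=> c' /opt[].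
exists (Tuple size_l); rewrite /= lV //; split; first by exists (Tuple size_l).
(* A competitor is bounded by the entry at its own counts, and that entry by the extracted one. *)
move=> _ [x ->]; have xT : rounds (counts_of x) = T by rewrite rounds_counts_of size_tuple.
have [|_ _ xmax] := opt (counts_of x); first by rewrite xT T_gt0 /=.
exact: le_trans (xmax x erefl) (cmax _ xT).
Qed.
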